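(* Let $a_i,b_i$ ($1\le i\le4$) be real numbers with $0\le a_i,b_i\le4$ and $a_i+b_i\ge4$ for $1\le i\le4$. Then the coefficient sequence of $$\prod_{i=1}^4(1+a_iz+z^2)(1+b_iz+z^2)$$ is strictly log-concave.
   Context: The coefficient sequence $(C_0,\dots,C_{16})$ of a degree-$16$ polynomial $\sum_{k=0}^{16}C_kz^k$ with nonnegative coefficients is strictly log-concave if $C_k^2-C_{k-1}C_{k+1}>0$ for all $1\le k\le15$. *)

(* Defs.v *)
From mathcomp Require Import all_boot all_order all_algebra.

Set Implicit Arguments.
Unset Strict Implicit.
Unset Printing Implicit Defensive.

Import GRing.Theory Num.Theory.
Local Open Scope ring_scope.

(* Strict log-concavity of the coefficient sequence (p`_0, ..., p`_n) of a
   polynomial of degree n with nonnegative coefficients. The degree and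
   nonnegativity are part of the predicate, because the notion only applies
   to such polynomials; the inequality ranges over interior indices only. *)
Definition strictly_log_concave_coefs (R : numDomainType) (n : nat)
    (p : {poly R}) : Prop :=
  [/\ size p = n.+1,
      forall k : nat, 0 <= p`_k
    & forall k : nat, (1 <= k <= n.-1)%N ->
        0 < p`_k ^+ 2 - p`_k.-1 * p`_k.+1].

(* Main.v *)
From Stdlib Require Import BinNat.
Require Import Defs.
From mathcomp Require Import all_boot all_order all_algebra.
From mathcomp Require Import reals.
From mathcomp Require Import zify ring lra.

Set Implicit Arguments.
Unset Strict Implicit.
Unset Printing Implicit Defensive.

Import Order.TTheory GRing.Theory Num.Theory.
Local Open Scope ring_scope.

(** For k fixed, f_k ^ 2 - f_{k-1} f_{k+1} is a quadratic form in f, with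
polar form E_k(f, g) = 2 f_k g_k - f_{k-1} g_{k+1} - f_{k+1} g_{k-1}. If all
the values E_k(F, G), for F and G in a finite family, are positive, then the
form is positive on the whole convex hull of the family, even though the set
of log-concave sequences is not convex.

A pair of factors gives
  (1 + a z + z^2)(1 + b z + z^2) = 1 + s z + (2 + p) z^2 + s z^3 + z^4
with s = a + b and p = a b, and this is affine in (s, p). The constraints on a
and b force (s, p) into the triangle with vertices (4, 0), (4, 4), (8, 16):
the edge from (4, 0) to (8, 16) is the inequality (4 - a)(4 - b) >= 0, the
edge on s = 4 is a + b >= 4, and the third edge is a chord of the parabola
4 p = s^2, which lies above the region 4 p <= s^2. So each pair is a convex
combination of the three quartics at the vertices ([pair_factorE]), which come
from (a, b) = (0, 4), (2, 2), (4, 4), and the product of four pairs is a convex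
combination of the 15 products of four of these quartics
([prod_convex_combination]). It remains to see that E_k is positive on every
two of these 15 polynomials, for 1 <= k <= 15. That is a comparison of explicit
natural numbers, which is decided by computation ([table_polar_gt0]).

The vertex (0, 4) gives 1 + 4z + 2z^2 + 4z^3 + z^4, whose coefficients are not
log-concave, nor are those of its square and cube. So log-concavity cannot be
had from that of the single pairs, and all four pairs are expanded at once. *)

(** * The polar form of the log-concavity defect *)

Definition polar (R : nzRingType) (k : nat) (f g : {poly R}) : R :=
  f`_k * g`_k *+ 2 - f`_k.-1 * g`_k.+1 - f`_k.+1 * g`_k.-1.

Section ConvexCombinations.
Variable R : realFieldType.
Implicit Types (f g : {poly R}) (k : nat).

Lemma polarC k f g : polar k f g = polar k g f.
Proof. by rewrite /polar; ring. Qed.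

Lemma polar_diag k f :
  polar k f f = (f`_k ^+ 2 - f`_k.-1 * f`_k.+1) *+ 2.
Proof. by rewrite /polar; ring. Qed.

Lemma polar_suml (I : finType) (w : I -> R) (F : I -> {poly R}) k g :
  polar k (\sum_i w i *: F i) g = \sum_i w i * polar k (F i) g.
Proof.
rewrite /polar !coef_sum !mulr_suml -sumrMnl -!sumrB.
by apply: eq_bigr => i _; rewrite !coefZ; ring.
Qed.

Lemma weighted_sum_gt0 (I : finType) (w e : I -> R) :
  (forall i, 0 <= w i) -> \sum_i w i = 1 -> (forall i, 0 < e i) ->
  0 < \sum_i w i * e i.
Proof.
move=> w_ge0 w1 e_gt0.
have we_ge0 i : true -> 0 <= w i * e i by rewrite mulr_ge0 // ltW.
rewrite lt_neqAle sumr_ge0 // andbT eq_sym psumr_eq0 //.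
apply/negP => /allP we0; have /eqP := w1; rewrite big1 ?(eq_sym 0) ?oner_eq0 //.
move=> i _; have /= := we0 i (mem_index_enum i).
by rewrite mulf_eq0 (gt_eqF (e_gt0 i)) orbF => /eqP.
Qed.

(** Expanding both arguments gives the double sum of w_i w_j E_k(F_i, F_j); the
diagonal terms alone would not suffice, hence the hypothesis on all pairs. *)
Lemma polar_convex_combination_gt0 (I : finType) (w : I -> R)
    (F : I -> {poly R}) k :
  (forall i, 0 <= w i) -> \sum_i w i = 1 ->
  (forall i j, 0 < polar k (F i) (F j)) ->
  0 < polar k (\sum_i w i *: F i) (\sum_i w i *: F i).
Proof.
move=> w_ge0 w1 F_gt0; rewrite polar_suml; apply: weighted_sum_gt0 => // i.
by rewrite polarC polar_suml; apply: weighted_sum_gt0.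
Qed.

(** One term per word phi choosing a vertex for each factor. *)
Lemma prod_convex_combination (n m : nat) (w : 'I_n -> 'I_m -> R)
    (V : 'I_m -> {poly R}) :
  \prod_i (\sum_j w i j *: V j) =
  \sum_(phi : {ffun 'I_n -> 'I_m})
    (\prod_i w i (phi i)) *: \prod_i V (phi i).
Proof.
by rewrite bigA_distr_bigA; apply: eq_bigr => phi _; rewrite scaler_prod.
Qed.

Lemma prod_weights_sum1 (n m : nat) (w : 'I_n -> 'I_m -> R) :
  (forall i, \sum_j w i j = 1) ->
  \sum_(phi : {ffun 'I_n -> 'I_m}) \prod_i w i (phi i) = 1.
Proof. by move=> w1; rewrite -bigA_distr_bigA big1. Qed.

End ConvexCombinations.

(** * Polynomials with explicit natural coefficients *)

(** Coefficient lists over binary naturals, so that products of coefficients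
of order 10^11 can be compared by computation. *)
Fixpoint addl (s t : seq N) : seq N :=
  match s, t with
  | [::], _ => t
  | _, [::] => s
  | x :: s', y :: t' => N.add x y :: addl s' t'
  end.

Fixpoint mull (s t : seq N) : seq N :=
  if s is x :: s' then addl (map (N.mul x) t) (N0 :: mull s' t) else [::].

Definition polarb (s t : seq N) (k : nat) : bool :=
  let c := nth N0 in
  N.ltb (N.add (N.mul (c s k.-1) (c t k.+1)) (N.mul (c s k.+1) (c t k.-1)))
        (N.mul 2 (N.mul (c s k) (c t k))).

Definition vertices : seq (seq N) :=
  [:: [:: 1; 4; 2; 4; 1]; [:: 1; 4; 6; 4; 1]; [:: 1; 8; 18; 8; 1]]%num.

(** The products of n vertex quartics. They depend only on the multiplicities of
the three factors, so that [undup] leaves 15 of the 81 words of length 4. *)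
Fixpoint table (n : nat) : seq (seq N) :=
  if n is n'.+1 then undup [seq mull v s | v <- vertices, s <- table n']
  else [:: [:: 1%num]].

Lemma table_polar_gt0 :
  all (fun s => all (fun t => all (polarb s t) (iota 1 15)) (table 4))
      (table 4).
Proof. by vm_compute. Qed.

Section Interpretation.
Variable R : realFieldType.

Definition nval (x : N) : R := (nat_of_bin x)%:R.
Definition npoly (s : seq N) : {poly R} := Poly (map nval s).

Lemma nvalD x y : nval (N.add x y) = nval x + nval y.
Proof. by rewrite /nval -natrD; congr _%:R; lia. Qed.

Lemma nvalM x y : nval (N.mul x y) = nval x * nval y.
Proof. by rewrite /nval -natrM; congr _%:R; lia. Qed.

Lemma nval_lt x y : N.ltb x y -> nval x < nval y.
Proof. by move=> xy; rewrite /nval ltr_nat; lia. Qed.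

Lemma coef_npoly s k : (npoly s)`_k = nval (nth N0 s k).
Proof.
rewrite coef_Poly; have [ks|sk] := ltnP k (size s); first exact: nth_map.
by rewrite !nth_default ?size_map.
Qed.

Lemma npoly_cons x s : npoly (x :: s) = (nval x)%:P + 'X * npoly s.
Proof. by rewrite /npoly /= cons_poly_def addrC mulrC. Qed.

Lemma npolyD s t : npoly (addl s t) = npoly s + npoly t.
Proof.
elim: s t => [|x s IHs] [|y t] /=; rewrite ?add0r ?addr0 //.
by rewrite !npoly_cons IHs nvalD polyCD; ring.
Qed.

Lemma npolyM s t : npoly (mull s t) = npoly s * npoly t.
Proof.
elim: s => [|x s IHs] /=; first by rewrite mul0r.
have npolyZ : npoly (map (N.mul x) t) = (nval x)%:P * npoly t.
  elim: t {IHs} => [|y t IHt] /=; first by rewrite mulr0.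
  by rewrite !npoly_cons IHt nvalM polyCM; ring.
by rewrite npolyD npolyZ !npoly_cons IHs polyC0; ring.
Qed.

Lemma polar_npoly_gt0 s t k : polarb s t k -> 0 < polar k (npoly s) (npoly t).
Proof.
move=> /nval_lt; rewrite /polar !coef_npoly nvalD !nvalM.
by rewrite (_ : nval 2 = 2%:R) //; lra.
Qed.

Definition vertex (j : 'I_3) : {poly R} := npoly (nth [::] vertices j).

Lemma prod_vertex_table (n : nat) (phi : 'I_n -> 'I_3) :
  exists2 s, s \in table n & \prod_i vertex (phi i) = npoly s.
Proof.
elim: n phi => [|n IHn] phi.
  exists [:: 1%num]; first by rewrite mem_head.
  by rewrite big_ord0 npoly_cons mulr0 addr0.
have [s s_table prod_s] := IHn (phi \o lift ord0).
exists (mull (nth [::] vertices (phi ord0)) s).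
  by rewrite mem_undup allpairs_f // mem_nth.
by rewrite big_ord_recl npolyM -prod_s.
Qed.

End Interpretation.

(** * A pair of factors as a convex combination *)

Section Pairs.
Variable R : realFieldType.

(** Barycentric coordinates of (a + b, a b) in the triangle with vertices
(4, 0), (4, 4), (8, 16). *)
Definition weight (a b : R) (j : 'I_3) : R :=
  [:: (3 * (a + b) - a * b - 8) / 4; (4 - a) * (4 - b) / 4; (a + b - 4) / 4]`_j.

Lemma weight_sum1 a b : \sum_j weight a b j = 1.
Proof. by rewrite !big_ord_recl big_ord0 /weight /=; field. Qed.

Lemma weight_ge0 a b j :
  0 <= a <= 4 -> 0 <= b <= 4 -> 4 <= a + b -> 0 <= weight a b j.
Proof.
move=> /andP[a0 a4] /andP[b0 b4] ab.
case: j => [[|[|[|//]]] lt_j]; rewrite /weight /= divr_ge0 //.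
- (* The chord lies above the parabola because (s - 4)(8 - s) >= 0. *)
  have := mulr_ge0 (_ : 0 <= a + b - 4) (_ : 0 <= 8 - (a + b)).
  have := sqr_ge0 (a - b).
  by rewrite expr2; nra.
- by rewrite mulr_ge0 ?subr_ge0.
- by rewrite subr_ge0.
Qed.

Lemma pair_factorE (a b : R) :
  (1 + a *: 'X + 'X^2) * (1 + b *: 'X + 'X^2) =
  \sum_j weight a b j *: vertex R j.
Proof.
have -> : (1 + a *: 'X + 'X^2) * (1 + b *: 'X + 'X^2) =
    Poly [:: 1; a + b; 2 + a * b; a + b; 1].
  by rewrite /= !cons_poly_def !polyCD polyCM -!mul_polyC; ring.
(* Both sides are explicit quartics; the last case is the zero tail. *)
apply/polyP => k; rewrite coef_sum !big_ord_recl big_ord0 !coefZ.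
rewrite !coef_npoly coef_Poly /weight /=.
by case: k => [|[|[|[|[|k]]]]]; rewrite /= ?nth_nil /nval /=; field.
Qed.

Lemma size_quadratic (a : R) : size (1 + a *: 'X + 'X^2) = 3%N.
Proof.
have -> : 1 + a *: 'X + 'X^2 = Poly [:: 1; a; 1].
  by rewrite /= !cons_poly_def -!mul_polyC; ring.
by rewrite (@PolyK _ 0) //= oner_eq0.
Qed.

End Pairs.

Theorem corollary4p5 (R : realType) (a b : 'I_4 -> R)
    (ha : forall i : 'I_4, 0 <= a i <= 4)
    (hb : forall i : 'I_4, 0 <= b i <= 4)
    (hab : forall i : 'I_4, 4 <= a i + b i) :
  strictly_log_concave_coefs 16
    (\prod_(i < 4) ((1 + a i *: 'X + 'X^2) * (1 + b i *: 'X + 'X^2))).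
Proof.
pose w i := weight (a i) (b i).
have w_ge0 i j : 0 <= w i j by apply: weight_ge0.
pose W (phi : {ffun 'I_4 -> 'I_3}) := \prod_i w i (phi i).
have W_ge0 phi : 0 <= W phi by apply: prodr_ge0.
have W1 : \sum_phi W phi = 1.
  by apply: prod_weights_sum1 => i; apply: weight_sum1.
set f := \prod_(i < 4) _.
have fE : f = \sum_phi W phi *: \prod_i vertex R (phi i).
  by rewrite -prod_convex_combination; apply: eq_bigr => i _; rewrite pair_factorE.
split=> [|k|k k_int].
- have sz i : size ((1 + a i *: 'X + 'X^2) * (1 + b i *: 'X + 'X^2)) = 5%N.
    by rewrite size_mul -?size_poly_eq0 !size_quadratic.
  rewrite size_prod => [|i _]; last by rewrite -size_poly_eq0 sz.
  by under eq_bigr => i _ do rewrite sz; rewrite sum_nat_const !card_ord.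
- rewrite fE coef_sum sumr_ge0 // => phi _.
  have [s _ ->] := prod_vertex_table R phi.
  by rewrite coefZ coef_npoly mulr_ge0 // ler0n.
- suff : 0 < polar k f f by rewrite polar_diag pmulrn_lgt0.
  rewrite fE; apply: polar_convex_combination_gt0 => // phi psi.
  have [s s_table ->] := prod_vertex_table R phi.
  have [t t_table ->] := prod_vertex_table R psi.
  have /allP/(_ s s_table)/allP/(_ t t_table)/allP st := table_polar_gt0.
  by apply: polar_npoly_gt0; apply: st; rewrite mem_iota.
Qed.
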